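(* Let $g\in\mathbb{N}$ and let $\boldsymbol{X}_{\mathbb{N}}=\{X_j\}_{j\in\mathbb{N}}$ be an infinite IID random sample with joint probability distribution $P_0^{\mathbb{N}}$ and marginal probability density $f_0\in\mathcal{F}_g$. For $n\in\mathbb{N}$ let $\boldsymbol{X}_n=\{X_j\}_{j=1}^n$ be the first $n$ elements of $\boldsymbol{X}_{\mathbb{N}}$, and let $\hat f_n\in\mathcal{F}_g$ be the maximum likelihood estimator, i.e. $\sum_{j=1}^n\log\hat f_n(X_j)=\sup_{f\in\mathcal{F}_g}\sum_{j=1}^n\log f(X_j)$. Then there exist two constants $C_1,C_2'>0$ such that for any sequence of positive numbers $\delta_n$ satisfying $$\sqrt n\,\delta_n^2\ge C_1\max\left\{\delta_n,\,C_2'\delta_n^{3/4}\right\}\quad\text{for all } n\in\mathbb{N},$$ we have, for all $n\in\mathbb{N}$ and all $\delta\ge\delta_n$, $$P_0^{\mathbb{N}}\left(H\left(\hat f_n,f_0\right)\ge\delta\right)\le C_1\exp\left(-n\delta^2/C_1^2\right).$$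
   Context: Write $[g]=\{1,\dots,g\}$. For $\theta\in(0,1)$ the triangular density on $[0,1]$ is $f(x;\theta)=2x/\theta$ if $x<\theta$ and $f(x;\theta)=2(1-x)/(1-\theta)$ if $x\ge\theta$; moreover $f(x;0)=2(1-x)$ and $f(x;1)=2x$. The class of polygonal densities with $g$ components is $$\mathcal{F}_g=\Big\{f(x)=\sum_{i=1}^g\pi_i f(x;\theta_i):\ \pi_i\ge0,\ \sum_{i=1}^g\pi_i=1,\ \theta_i\in[0,1],\ i\in[g]\Big\}.$$ For densities $f,h$ on $[0,1]$, the Hellinger divergence $H(f,h)\ge0$ is given by $H^2(f,h)=\int_0^1(f^{1/2}-h^{1/2})^2\,dx$. *)

(* Defs.v *)
From HB Require Import structures.
From mathcomp Require Import all_boot all_order all_algebra finmap.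
From mathcomp Require Import all_classical all_reals all_analysis.

Set Implicit Arguments.
Unset Strict Implicit.
Unset Printing Implicit Defensive.

Import Order.TTheory GRing.Theory Num.Theory.
Import numFieldNormedType.Exports.

Local Open Scope classical_set_scope.
Local Open Scope ring_scope.

(* Densities on [0, 1] are total functions R -> R that vanish outside [0, 1].
   The endpoint values theta = 0 and theta = 1 are separate cases: the general
   formula would give 0 instead of 2 at x = theta = 1, because 1 / 0 = 0. *)
Definition triangular {R : realType} (theta x : R) : R :=
  if 0 <= x <= 1 then
    if theta == 0 then 2 * (1 - x)
    else if theta == 1 then 2 * x
    else if x < theta then 2 * x / theta
    else 2 * (1 - x) / (1 - theta)
  else 0.

Definition polygonal (R : realType) (g : nat) : set (R -> R) :=
  [set f | exists w theta : 'I_g -> R,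
    [/\ forall i, 0 <= w i,
        \sum_(i < g) w i = 1,
        forall i, 0 <= theta i <= 1 &
        f = (fun x => \sum_(i < g) w i * triangular (theta i) x)]].

Definition hellinger {R : realType} (f h : R -> R) : R :=
  Num.sqrt (\int[@lebesgue_measure R]_(x in `[0, 1])
    (Num.sqrt (f x) - Num.sqrt (h x)) ^+ 2).

Definition mutually_independent d (T : measurableType d) (R : realType)
    (P : probability T R) (X : nat -> {RV P >-> R}) : Prop :=
  forall (J : {fset nat}) (A : nat -> set R),
    (forall j, measurable (A j)) ->
    P (\bigcap_(j in [set` J]) (X j @^-1` A j)) =
    (\prod_(j <- J) P (X j @^-1` A j))%E.

Definition has_density d (T : measurableType d) (R : realType)
    (P : probability T R) (Y : {RV P >-> R}) (f : R -> R) : Prop :=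
  forall A : set R, measurable A ->
    distribution P Y A = (\int[@lebesgue_measure R]_(x in A) (f x)%:E)%E.

Definition iid_sample d (T : measurableType d) (R : realType)
    (P : probability T R) (X : nat -> {RV P >-> R}) (f : R -> R) : Prop :=
  mutually_independent X /\ forall j, has_density (X j) f.

(* Extended-real valued, with log 0 = -oo. *)
Definition log_likelihood {R : realType} (n : nat) (x : nat -> R)
    (f : R -> R) : \bar R :=
  (\sum_(j < n) lne (f (x j))%:E)%E.

Definition is_mle {R : realType} (g n : nat) (x : nat -> R) (f : R -> R)
    : Prop :=
  polygonal g f /\
  log_likelihood n x f =
    ereal_sup [set log_likelihood n x h | h in @polygonal R g].

(* Main.v *)
Require Import Defs.
From HB Require Import structures.
From mathcomp Require Import all_boot all_order all_algebra finmap.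
From mathcomp Require Import all_classical all_reals all_analysis.
From mathcomp Require Import measurable_realfun.
From mathcomp Require Import ring lra.

Set Implicit Arguments.
Unset Strict Implicit.
Unset Printing Implicit Defensive.

Import Order.TTheory GRing.Theory Num.Theory.
Import numFieldNormedType.Exports.

Local Open Scope classical_set_scope.
Local Open Scope ring_scope.

(* The rate condition forces delta_n >= C n^(-2/5), which is so much slower
   than the parametric rate that a crude union bound replaces chaining.
   Discretising weights and peaks with mesh 1/n^2 gives (n^2+1)^(2g) upper
   brackets u, whose integrals exceed 1 by O(n^(-2)) only.  If the maximum
   likelihood estimator f lies below u and H(f, f0) >= delta, then the
   likelihood of u is at least that of f0, which by Markov's inequality for the
   square root of the likelihood ratio has probability at most
   (\int sqrt(u f0))^n <= (1 - delta^2/4)^n <= exp(-n delta^2/4).  Since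
   (n delta^2)^5 >= C^8 n, half of the exponent absorbs the number of
   brackets. *)

(** * Integration against a measure known through weighted indicators *)

Section weighted_integral.
Context d d' (T : measurableType d) (T' : measurableType d') (R : realType).
Variables (mu : {measure set T -> \bar R}) (nu : {measure set T' -> \bar R}).
Variables (X : T' -> T) (mX : measurable_fun setT X).
Variables (Y : T' -> R) (mY : measurable_fun setT Y).
Hypothesis Y0 : forall x, 0 <= Y x.
Variables (c : R) (c0 : 0 <= c).
Hypothesis muE : forall A : set T, measurable A ->
  (c%:E * mu A = \int[nu]_x (Y x * \1_A (X x))%:E)%E.

Import HBNNSimple.

Lemma weighted_integral_nnsfun (h : {nnsfun T >-> R}) :
  (c%:E * \int[mu]_x (h x)%:E = \int[nu]_x (Y x * h (X x))%:E)%E.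
Proof.
pose s := fset_set (h @` setT).
have s0 (i : 'I_#|` s|) : 0 <= s`_i.
  have : s`_i \in s by exact: mem_nth.
  by rewrite in_fset_set// inE => -[x _ <-].
have mA (i : 'I_#|` s|) : measurable (h @^-1` [set s`_i]) by exact: measurable_sfunP.
have mi (i : 'I_#|` s|) : measurable_fun setT (\1_(h @^-1` [set s`_i]) : T -> R).
  exact: measurable_indic.
under eq_integral do rewrite fimfunEord -sumEFin.
under [in RHS]eq_integral do rewrite fimfunEord mulr_sumr -sumEFin.
rewrite ge0_integral_sum//; last 2 first.
  by move=> i; apply/measurable_EFinP/measurable_funM.
  by move=> i x _; rewrite lee_fin mulr_ge0.
rewrite ge0_integral_sum//; last 2 first.
  move=> i; apply/measurable_EFinP/measurable_funM => //.
  by apply: measurable_funM => //; exact: measurableT_comp.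
  by move=> i x _; rewrite lee_fin !mulr_ge0.
rewrite ge0_sume_distrr; last first.
  by move=> i _; apply: integral_ge0 => x _; rewrite lee_fin mulr_ge0.
apply: eq_bigr => i _.
under eq_integral do rewrite EFinM.
have si0 : (0 <= (s`_i)%:E)%E by rewrite lee_fin.
have mEi : measurable_fun setT (fun x => (\1_(h @^-1` [set s`_i]) x : R)%:E).
  exact/measurable_EFinP.
rewrite ge0_integralZl//.
rewrite integral_indic// setIT.
rewrite muleCA muE// -ge0_integralZl//; last 2 first.
  apply/measurable_EFinP/measurable_funM => //; exact: measurableT_comp.
  by move=> x _; rewrite lee_fin mulr_ge0.
by apply: eq_integral => x _; rewrite -EFinM mulrCA.
Qed.

(** Simple functions and monotone convergence extend [muE] beyond indicators. It serves twice: with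
    [Y] the product of the other factors it splits one variable off an expectation, and with [X] the
    identity and [Y] a density it integrates against the law of an observation. *)
Lemma weighted_integral (h : T -> R) (mh : measurable_fun setT h)
    (h0 : forall x, 0 <= h x) :
  (c%:E * \int[mu]_x (h x)%:E = \int[nu]_x (Y x * h (X x))%:E)%E.
Proof.
have mEh : measurable_fun setT (EFin \o h) by exact/measurable_EFinP.
pose s := nnsfun_approx measurableT mEh.
have sh x : (s n x)%:E @[n --> \oo] --> (h x)%:E.
  by apply: cvg_nnsfun_approx => // y _; rewrite lee_fin.
have nd x : nondecreasing_seq (s ^~ x).
  by move=> m n mn; exact/lefP/nd_nnsfun_approx.
rewrite -ge0_integralZl//; last by move=> x _; rewrite lee_fin.
transitivity (\int[mu]_x limn (fun n => c%:E * (s n x)%:E))%E.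
  by apply: eq_integral => x _; apply/esym/cvg_lim => //; exact: cvgeZl.
transitivity (\int[nu]_x limn (fun n => (Y x)%:E * (s n (X x))%:E))%E; last first.
  by apply: eq_integral => x _; apply/cvg_lim => //; rewrite EFinM; exact: cvgeZl.
rewrite !monotone_convergence//; first last.
- by move=> x _ m n mn; rewrite lee_wpmul2l ?lee_fin//; exact: nd.
- by move=> n x _; rewrite -EFinM lee_fin mulr_ge0.
- by move=> n; apply/measurable_EFinP/measurable_funM.
- by move=> x _ m n mn; rewrite lee_wpmul2l ?lee_fin//; exact: nd.
- by move=> n x _; rewrite -EFinM lee_fin mulr_ge0.
- by move=> n; apply/measurable_EFinP/measurable_funM => //; exact: measurableT_comp.
congr (limn _); apply/funext => n.
rewrite ge0_integralZl//; last 2 first.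
  exact/measurable_EFinP.
  by move=> x _; rewrite lee_fin.
by rewrite weighted_integral_nnsfun; apply: eq_integral => x _; rewrite EFinM.
Qed.

End weighted_integral.

(** * Expectation of a product of functions of independent variables *)

Section expectation_prod.
Context d (T : measurableType d) (R : realType) (P : probability T R).
Variables (X : nat -> {RV P >-> R}) (X_indep : mutually_independent X).

Lemma expectation_prod_indic n (A : nat -> set R) :
  (forall j, measurable (A j)) ->
  (\int[P]_w (\prod_(i < n) \1_(A i) (X i w))%:E =
   \prod_(i < n) P (X i @^-1` A i))%E.
Proof.
move=> mA; pose J := [fset j in iota 0 n]%fset.
have J_iota : perm_eq J (iota 0 n).
  by apply: uniq_perm => [||j]; rewrite ?fset_uniq ?iota_uniq// !inE.
have := X_indep J mA; rewrite (perm_big _ J_iota)/=.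
rewrite -{1}(subn0 n) big_mkord => <-.
have mXA j : measurable (X j @^-1` A j) by rewrite -[X in measurable X]setTI; exact: measurable_funP.
have mB : measurable (\bigcap_(j in [set` J]) X j @^-1` A j).
  exact: fin_bigcap_measurable.
transitivity (\int[P]_w (\1_(\bigcap_(j in [set` J]) X j @^-1` A j) w)%:E)%E; last first.
  by rewrite integral_indic// setIT.
apply: eq_integral => w _; congr EFin; rewrite [RHS]indicE.
have [/set_mem wB|/negP wB] := boolP (w \in _).
  rewrite big1// => i _; rewrite indicE mem_set//.
  by apply: (wB i); rewrite /= !inE mem_iota /= add0n ltn_ord.
apply/eqP/contraT => nz; exfalso; apply: wB; rewrite inE => j /=.
rewrite !inE mem_iota /= add0n => jn.
move/prodf_neq0: nz => /(_ (Ordinal jn) isT) /=.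
by rewrite indicE; case: (boolP (_ \in _)) => [/set_mem//|]; rewrite eqxx.
Qed.

Lemma expectation_prod n (h : nat -> R -> R) (M : nat -> R) :
  (forall j, measurable_fun setT (h j)) -> (forall j x, 0 <= h j x) ->
  (forall j, \int[P]_w (h j (X j w))%:E = (M j)%:E)%E ->
  (\int[P]_w (\prod_(i < n) h i (X i w))%:E = (\prod_(i < n) M i)%:E)%E.
Proof.
move=> mh h0 hM.
(* Indicators are replaced by the h j one coordinate at a time. *)
suff: forall m, (m <= n)%N -> forall (h : nat -> R -> R) (M : nat -> R),
  (forall j, measurable_fun setT (h j)) -> (forall j x, 0 <= h j x) ->
  (forall j, \int[P]_w (h j (X j w))%:E = (M j)%:E)%E ->
  (forall j, (m <= j)%N -> exists2 A, measurable A & h j = \1_A) ->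
  (\int[P]_w (\prod_(i < n) h i (X i w))%:E = (\prod_(i < n) M i)%:E)%E.
  (* From index [n] on, the constant 1, seen as an indicator, replaces [h j]; the claim for [m = n]
     then applies and the product over [i < n] is unchanged. *)
  pose h' j := if (j < n)%N then h j else \1_setT.
  pose M' j := if (j < n)%N then M j else 1.
  move=> /(_ n (leqnn n) h' M') H.
  transitivity (\int[P]_w (\prod_(i < n) h' i (X i w))%:E)%E.
    by apply: eq_integral => w _; congr EFin; apply: eq_bigr => i _; rewrite /h' ltn_ord.
  rewrite H; first by congr EFin; apply: eq_bigr => i _; rewrite /M' ltn_ord.
  - by move=> j; rewrite /h'; case: ifP => // _; exact: measurable_indic.
  - by move=> j x; rewrite /h'; case: ifP.
  - move=> j; rewrite /h' /M'; case: ifP => // _.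
    rewrite indicT /= integral_cst// mul1e. exact: probability_setT.
  - move=> j nj; exists setT => //; by rewrite /h' ltnNge nj.
elim=> [_|m IH mn] {mh h0 hM}{}h {}M mh h0 hM hA.
  have {}hA j : {A | measurable A & h j = \1_A} by apply: cid2; exact: hA.
  pose A j := s2val (hA j).
  have mA j : measurable (A j) by rewrite /A; case: (hA j).
  have hE j : h j = \1_(A j) by rewrite /A; case: (hA j).
  under eq_integral do under eq_bigr do rewrite hE.
  rewrite expectation_prod_indic// -prodEFin; apply: eq_bigr => i _.
  rewrite -hM hE.
  have mXA : measurable (X i @^-1` A i) by rewrite -[X in measurable X]setTI; exact: measurable_funP.
  by rewrite -[X in P X]setIT -integral_indic//; apply: eq_integral.
pose im := Ordinal mn.
pose Y w := \prod_(i < n | i != im) h i (X i w).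
pose c := \prod_(i < n | i != im) M i.
have M0 j : 0 <= M j.
  by rewrite -lee_fin -hM; apply: integral_ge0 => w _; rewrite lee_fin.
have c0 : 0 <= c by apply: prodr_ge0.
have Y0 w : 0 <= Y w by apply: prodr_ge0.
have mhX (i : 'I_n) : measurable_fun setT (fun w => h i (X i w)).
  exact: measurableT_comp.
have mY : measurable_fun setT Y.
  rewrite /Y; under eq_fun do rewrite -big_filter.
  exact: measurable_prod.
have mXm : measurable_fun setT (X m) by exact: measurable_funP.
(* With [h m] replaced by the indicator of [A], the induction hypothesis is exactly the identity
   that [weighted_integral] asks for, the remaining factors forming the weight [Y] of mean [c]. *)
have key A : measurable A ->
    (c%:E * distribution P (X m) A = \int[P]_w (Y w * \1_A (X m w))%:E)%E.
  move=> mA.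
  have mXA : measurable (X m @^-1` A) by rewrite -[X in measurable X]setTI; exact: mXm.
  pose h' j := if j == m then \1_A else h j.
  pose M' j := if j == m then fine (P (X m @^-1` A)) else M j.
  have h'm : h' m = \1_A by rewrite /h' eqxx.
  have M'm : M' m = fine (P (X m @^-1` A)) by rewrite /M' eqxx.
  have := IH (ltnW mn) h' M'; rewrite [X in X%:E](bigD1 im)//= M'm => H.
  rewrite /distribution /pushforward/=.
  rewrite -[P (X m @^-1` A)]fineK ?fin_num_measure// -EFinM mulrC.
  transitivity (fine (P (X m @^-1` A)) * \prod_(i < n | i != im) M' i)%:E.
    congr (_ * _)%:E; apply: eq_bigr => i im'; rewrite /M' ifF//.
    by apply/negbTE; apply: contra im' => /eqP im'; apply/eqP/val_inj.
  rewrite -H.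
  - apply: eq_integral => w _; congr EFin; rewrite (bigD1 im)//= h'm mulrC.
    congr (_ * _); apply: eq_bigr => i im'; rewrite /h' ifF//.
    by apply/negbTE; apply: contra im' => /eqP im'; apply/eqP/val_inj.
  - by move=> j; rewrite /h'; case: ifP => // _; exact: measurable_indic.
  - by move=> j x; rewrite /h'; case: ifP.
  - move=> j; rewrite /h' /M'; case: eqP => [->|//].
    rewrite fineK ?fin_num_measure//.
    by rewrite -[X in P X]setIT -integral_indic//; apply: eq_integral.
  - move=> j mj; rewrite /h'; case: eqP => [_|/eqP jm]; first by exists A.
    by apply: hA; rewrite ltn_neqAle eq_sym jm.
have := weighted_integral mXm mY Y0 c0 key (mh m) (h0 m).
rewrite ge0_integral_distribution//; last 2 first.
  exact/measurable_EFinP.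
  by move=> x; rewrite lee_fin.
rewrite /= hM => cM.
rewrite (bigD1 im)//= mulrC EFinM cM.
by apply: eq_integral => w _; rewrite (bigD1 im)//= mulrC.
Qed.

End expectation_prod.

(* The pointwise supremum of the triangular densities with peak in [a, b]. *)
Definition bracket {R : realType} (a b x : R) : R :=
  if 0 <= x <= 1 then
    if x < a then 2 * x / a else if x <= b then 2 else 2 * (1 - x) / (1 - b)
  else 0.

(** * Envelopes of triangular densities: order, measurability, integral *)

Section bracket.
Context {R : realType}.
Implicit Types a b t x : R.

Lemma bracket_ge0 a b x : 0 <= bracket a b x.
Proof.
rewrite /bracket; case: ifP => // /andP[x0 x1]; case: (ltP x a) => xa.
  by rewrite divr_ge0 ?mulr_ge0// (le_trans x0 (ltW xa)).
by case: (leP x b) => // bx; rewrite divr_ge0 ?mulr_ge0 ?subr_ge0// (le_trans (ltW bx)).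
Qed.

Lemma bracket_le2 a b x : bracket a b x <= 2.
Proof.
rewrite /bracket; case: ifP => // /andP[x0 x1]; case: (ltP x a) => xa.
  by rewrite ler_pdivrMr ?ler_pM2l// ?ltW// (le_lt_trans x0 xa).
case: (leP x b) => // bx; rewrite ler_pdivrMr ?ler_pM2l//.
  by rewrite lerB// ltW.
by rewrite subr_gt0 (lt_le_trans bx).
Qed.

Lemma le_bracket a b a' b' x : a' <= a -> a <= b -> b <= b' ->
  bracket a b x <= bracket a' b' x.
Proof.
move=> aa ab bb; rewrite {2}/bracket; case: ifPn => [x01|/negbTE x01]; last first.
  by rewrite /bracket x01.
have /andP[x0 x1] := x01; case: (ltP x a') => xa.
  rewrite /bracket x01 (lt_le_trans xa aa) ler_wpM2l ?mulr_ge0//.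
  have a'0 := le_lt_trans x0 xa.
  by rewrite lef_pV2// posrE (lt_le_trans a'0).
case: (leP x b') => bx; first exact: bracket_le2.
have bx' := le_lt_trans bb bx.
rewrite /bracket x01 (ltNge x) (ltW (le_lt_trans ab bx')) /= (leNgt x) bx'/=.
rewrite ler_wpM2l ?mulr_ge0 ?subr_ge0//.
rewrite lef_pV2 ?posrE ?subr_gt0 ?(lt_le_trans bx' x1) ?(lt_le_trans bx x1)//.
by rewrite lerB.
Qed.

(** The peak value 2 is a branch of its own in [bracket], so for [t = 0] or [t = 1] the branch with
    denominator zero is never reached inside [0, 1]. *)
Lemma triangularE t : 0 <= t <= 1 -> triangular t = bracket t t.
Proof.
move=> /andP[t0 t1]; apply/funext => x; rewrite /triangular /bracket.
case: ifP => // /andP[x0 x1].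
have [->|tn0] := eqVneq t 0.
  rewrite (ltNge x) x0/=; case: (leP x 0) => [xle0|_]; last by rewrite subr0 divr1.
  by rewrite (le_anti (introT andP (conj xle0 x0))) subr0 mulr1.
have [->|tn1] := eqVneq t 1.
  rewrite x1 divr1; case: (ltP x 1) => // x1'.
  by rewrite (le_anti (introT andP (conj x1 x1'))) mulr1.
case: (ltgtP x t) => // ->; rewrite mulfK// subr_eq0 eq_sym//.
Qed.

Lemma measurable_bracket a b : measurable_fun setT (bracket a b).
Proof.
rewrite /bracket; apply: measurable_fun_ifT => //=.
  by apply: measurable_and; exact: measurable_fun_ler.
apply: measurable_fun_ifT => //=; first exact: measurable_fun_ltr.
  by apply: measurable_funM => //; exact: measurable_funM.
apply: measurable_fun_ifT => //=; first exact: measurable_fun_ler.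
apply: measurable_funM => //; apply: measurable_funM => //.
exact: measurable_funB.
Qed.

Local Notation mu := (@lebesgue_measure R).

Lemma bounded_integrable_itv (l r : bool) (u v : R) (f : R -> R) (M : R) :
  measurable_fun setT f -> (forall x, `|f x| <= M) ->
  mu.-integrable [set` Interval (BSide l u) (BSide r v)] (EFin \o f).
Proof.
move=> mf fM; apply: measurable_bounded_integrable => //=.
- by rewrite lebesgue_measure_itv/=; case: ifP => _; rewrite -?EFinB ltry.
- exact: measurable_funTS.
- by exists M; split; [exact: num_real|move=> y /ltW My x _; exact: le_trans My].
Qed.

Lemma Rintegral_affine (p q c d : R) : c <= d ->
  \int[mu]_(x in `[c, d]) (p * x + q) = p * (d ^+ 2 - c ^+ 2) / 2 + q * (d - c).
Proof.
rewrite le_eqVlt => /predU1P[->|cd].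
  by rewrite set_itv1 Rintegral_set1 !subrr; ring.
pose F x := p / 2 * x ^+ 2 + q * x.
have dF (x : R) : is_derive x 1 F (p * x + q).
  rewrite /F; apply: is_derive_eq.
  by rewrite /GRing.scale/= !mulr1 -mulr2n -[x *+ 2]mulr_natl mulrA divfK.
have dvF (x : R) : derivable F x 1 by case: (dF x).
have cF (x : R) : {for x, continuous F}.
  by apply: differentiable_continuous; exact/derivable1_diffP.
rewrite /Rintegral (@continuous_FTC2 _ _ F)//=.
- by rewrite /F; field.
- apply: continuous_subspaceT => x.
  apply: cvgD; last exact: cvg_cst.
  by apply: cvgM; [exact: cvg_cst|exact: cvg_id].
- split.
  + by move=> x _.
  + by apply: cvg_at_right_filter; exact: cF.
  + by apply: cvg_at_left_filter; exact: cF.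
- by move=> x _; rewrite derive1E; apply: derive_val.
Qed.

(** Cutting at [a] and [b] leaves a triangle of area [a], a rectangle of area [2 * (b - a)] and a
    triangle of area [1 - b]. The excess over 1 is the length of the interval of peaks. *)
Lemma Rintegral_bracket a b : 0 <= a -> a <= b -> b <= 1 ->
  \int[mu]_(x in `[0, 1]) bracket a b x = 1 + b - a.
Proof.
move=> a0 ab b1.
have ib l r u v :
    mu.-integrable [set` Interval (BSide l u) (BSide r v)] (EFin \o bracket a b).
  apply: (@bounded_integrable_itv _ _ _ _ _ 2); first exact: measurable_bracket.
  by move=> x; rewrite ger0_norm ?bracket_le2 ?bracket_ge0.
have := @Rintegral_itvB _ (bracket a b) (BLeft 0) (BRight 1) b (ib _ _ _ _).
rewrite !bnd_simp => /(_ (le_trans a0 ab) b1) /eqP; rewrite subr_eq => /eqP ->.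
have := @Rintegral_itvB _ (bracket a b) (BLeft 0) (BRight b) a (ib _ _ _ _).
rewrite !bnd_simp => /(_ a0 ab) /eqP; rewrite subr_eq => /eqP ->.
have -> : \int[mu]_(x in `]b, 1]) bracket a b x = 1 - b.
  rewrite Rintegral_itv_obnd_cbnd//.
  have [->|bn1] := eqVneq b 1; first by rewrite set_itv1 Rintegral_set1 subrr.
  transitivity (\int[mu]_(x in `[b, 1]) (- 2 / (1 - b) * x + 2 / (1 - b))).
    apply: eq_Rintegral => x; rewrite inE/= in_itv/= => /andP[bx x1].
    rewrite /bracket (le_trans _ bx) ?(le_trans a0)// x1 /=.
    rewrite (ltNge x) (le_trans ab bx) /=; case: (leP x b) => xb; last by ring.
    rewrite (le_anti (introT andP (conj xb bx))).
    by field; rewrite subr_eq0 eq_sym.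
  by rewrite Rintegral_affine//; field; rewrite subr_eq0 eq_sym.
have -> : \int[mu]_(x in `]a, b]) bracket a b x = 2 * (b - a).
  transitivity (\int[mu]_(x in `]a, b]) (cst 2 x)).
    apply: eq_Rintegral => x.
    rewrite inE/= in_itv/= => /andP[ax xb]; rewrite /bracket.
    by rewrite (le_trans a0 (ltW ax)) (le_trans xb)// /= (ltNge x) (ltW ax) xb.
  rewrite Rintegral_cst//= lebesgue_measure_itv/=; case: ifPn => //=.
  by rewrite lte_fin -leNgt => ba; rewrite (le_anti (introT andP (conj ab ba))) subrr.
have -> : \int[mu]_(x in `[0, a]) bracket a b x = a.
  have [->|an0] := eqVneq a 0; first by rewrite set_itv1 Rintegral_set1.
  transitivity (\int[mu]_(x in `[0, a]) (2 / a * x + 0)).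
    apply: eq_Rintegral => x; rewrite inE/= in_itv/= => /andP[x0 xa].
    rewrite /bracket x0 (le_trans xa)// ?(le_trans ab)//=; case: (ltP x a) => ax.
      by rewrite addr0 mulrAC.
    by rewrite (le_anti (introT andP (conj xa ax))) ab addr0 divfK.
  by rewrite Rintegral_affine//; field.
by ring.
Qed.
End bracket.

(** * Likelihood ratios under the true density *)

Lemma sqrtr_prod (R : rcfType) n (a : 'I_n -> R) : (forall i, 0 <= a i) ->
  \prod_i Num.sqrt (a i) = Num.sqrt (\prod_i a i).
Proof.
move=> a0; suff [] : \prod_i Num.sqrt (a i) = Num.sqrt (\prod_i a i) /\
  0 <= \prod_i a i by [].
elim/big_rec2: _ => [|i x y _ [-> x0]]; first by rewrite sqrtr1.
by rewrite sqrtrM// mulr_ge0.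
Qed.

Section likelihood_ratio.
Context d (T : measurableType d) (R : realType) (P : probability T R).
Variables (X : nat -> {RV P >-> R}) (f0 : R -> R) (X_iid : iid_sample X f0).
Hypotheses (mf0 : measurable_fun setT f0) (f0_ge0 : forall x, 0 <= f0 x).

Local Notation mu := (@lebesgue_measure R).

Lemma expectation_density j (h : R -> R) :
  measurable_fun setT h -> (forall x, 0 <= h x) ->
  (\int[P]_w (h (X j w))%:E = \int[mu]_x (f0 x * h x)%:E)%E.
Proof.
move=> mh h0; have [_ /(_ j) dens] := X_iid.
have mid : measurable_fun setT (id : measurableTypeR R -> R) by [].
have dE (A : set R) : measurable A ->
    (1%:E * distribution P (X j) A = \int[mu]_x (f0 x * \1_A (id x))%:E)%E.
  move=> mA; rewrite mul1e dens// integral_mkcond; apply: eq_integral => x _.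
  rewrite patchE indicE; case: ifP => _; by rewrite ?mulr1 ?mulr0.
have := weighted_integral mid mf0 f0_ge0 ler01 dE mh h0.
rewrite mul1e => <-; rewrite ge0_integral_distribution//.
exact/measurable_EFinP.
Qed.

(** The zero set of [f0] has mass zero under each observation, and there are countably many
    observations. This makes division by [f0] along the sample legitimate. *)
Lemma density_neq0_ae : {ae P, forall w, forall j, f0 (X j w) != 0}.
Proof.
have neg j : P.-negligible (X j @^-1` (f0 @^-1` [set 0])).
  have m0 : measurable (f0 @^-1` [set 0]).
    by rewrite -[X in measurable X]setTI; exact: mf0.
  have mX0 : measurable (X j @^-1` (f0 @^-1` [set 0])).
    by rewrite -[X in measurable X]setTI; exact: measurable_funP.
  apply/negligibleP => //; have [_ /(_ j) dens] := X_iid.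
  transitivity (distribution P (X j) (f0 @^-1` [set 0])) => //.
  by rewrite dens// integral0_eq// => x /= ->.
apply: negligibleS (negligible_bigcup neg) => w /=.
by move=> /existsNP[j /negP/negPn/eqP jw]; exists j.
Qed.

Lemma likelihood_ratio n (u : R -> R) (B : R) : measurable_fun setT u ->
  (forall x, 0 <= u x) -> (forall x, Num.sqrt (u x * f0 x) <= B) ->
  (forall x, ~~ (0 <= x <= 1) -> f0 x = 0) ->
  (P [set w | (\prod_(i < n) f0 (X i w) <= \prod_(i < n) u (X i w))%R] <=
    ((\int[mu]_(x in `[0%R, 1%R]) Num.sqrt (u x * f0 x)) ^+ n)%R%:E)%E.
Proof.
move=> meas_u u0 uB f01.
have msqrt : measurable_fun setT (@Num.sqrt R).
  exact: continuous_measurable_fun (@sqrt_continuous R).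
(* Where [f0] vanishes, division by zero gives [h x = 0], and both sides of [fh] below are 0. *)
pose h x := Num.sqrt (u x / f0 x).
have mh : measurable_fun setT h.
  apply: measurableT_comp => //; apply: measurable_funM => //.
  (* On nonnegative reals the inverse, with value 0 at 0, is the real power of exponent -1, whose
     measurability is known. *)
  rewrite (_ : (fun _ => _) = (fun x => f0 x `^ -1)); last first.
    by apply/funext => x; rewrite powR_inv1.
  exact: measurableT_comp (measurable_powR (-1)) mf0.
have h0 x : 0 <= h x by exact: sqrtr_ge0.
have fh x : f0 x * h x = Num.sqrt (u x * f0 x).
  rewrite /h; have [->|f0n] := eqVneq (f0 x) 0; first by rewrite !(mul0r,mulr0,sqrtr0).
  rewrite -{1}[f0 x]sqr_sqrtr// expr2 -!mulrA -sqrtrM// mulrCA mulfV// mulr1.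
  by rewrite mulrC -sqrtrM.
pose M := \int[mu]_(x in `[0, 1]) Num.sqrt (u x * f0 x).
have hM j : (\int[P]_w (h (X j w))%:E = M%:E)%E.
  rewrite expectation_density// /M /Rintegral fineK; last first.
    apply: integrable_fin_num => //.
    apply: (@bounded_integrable_itv _ _ _ _ _ _ B).
      by apply: measurableT_comp => //; exact: measurable_funM.
    by move=> x; rewrite ger0_norm ?sqrtr_ge0.
  rewrite [RHS]integral_mkcond; apply: eq_integral => x _; rewrite fh patchE.
  case: ifPn => //; rewrite notin_setE/= in_itv/= => /negP/f01 ->.
  by rewrite mulr0 sqrtr0.
have mX j (v : R -> R) : measurable_fun setT v -> measurable_fun setT (v \o X j).
  by move=> mv; exact: measurableT_comp.
have mprod (v : R -> R) : measurable_fun setT v ->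
    measurable_fun setT (fun w => \prod_(i < n) v (X i w)).
  by move=> mv; apply: measurable_prod => i _; exact: mX.
set E := [set _ | _].
have mE : measurable E.
  rewrite -[E]setTI.
  exact: (measurable_fun_ler (mprod _ mf0) (mprod _ meas_u) measurableT
            (Y := [set true])).
have := @expectation_prod _ _ _ _ _ (proj1 X_iid) n (fun=> h) (fun=> M)
  (fun=> mh) (fun=> h0) hM.
rewrite prodr_const card_ord => <-.
(* Markov's inequality by comparison of integrands: almost surely on [E] the product of the
   [h (X i w)] is at least 1, and elsewhere it is nonnegative. *)
rewrite -[E]setIT -integral_indic//; apply: ae_ge0_le_integral => //.
- exact/measurable_EFinP/measurable_indic.
- by move=> w _; rewrite lee_fin prodr_ge0.
- exact/measurable_EFinP/mprod.
apply: filterS density_neq0_ae => w w0 _; rewrite lee_fin indicE.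
case: (boolP (w \in E)) => [|_]; last by rewrite prodr_ge0.
rewrite inE /E/= => fu.
have f0p i : 0 < f0 (X i w) by rewrite lt_neqAle eq_sym w0/=.
rewrite -[leLHS]sqrtr1 /h.
rewrite sqrtr_prod => [|i]; last by rewrite divr_ge0.
rewrite ler_wsqrtr// prodf_div ler_pdivlMr ?mul1r//.
by apply: prodr_gt0.
Qed.

End likelihood_ratio.

(** * Mixtures of envelopes and the finite grid of upper brackets *)

Section mixture.
Context {R : realType} (g : nat).
Implicit Types w a b : 'I_g -> R.
Local Notation mu := (@lebesgue_measure R).

Definition mixture w a b (x : R) : R := \sum_(i < g) w i * bracket (a i) (b i) x.

Lemma polygonal_mixture (f : R -> R) : polygonal g f ->
  exists w t : 'I_g -> R, [/\ forall i, 0 <= w i, \sum_(i < g) w i = 1,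
    forall i, 0 <= t i <= 1 & f = mixture w t t].
Proof.
move=> [w [t [w0 w1 t01 ->]]]; exists w, t; split => //.
by apply/funext => x; apply: eq_bigr => i _; rewrite triangularE.
Qed.

Lemma measurable_mixture w a b : measurable_fun setT (mixture w a b).
Proof.
apply: measurable_sum => i; apply: measurable_funM => //.
exact: measurable_bracket.
Qed.

Lemma mixture_ge0 w a b x : (forall i, 0 <= w i) -> 0 <= mixture w a b x.
Proof. by move=> w0; apply: sumr_ge0 => i _; rewrite mulr_ge0 ?bracket_ge0. Qed.

Lemma mixture_le w a b x : (forall i, 0 <= w i) ->
  mixture w a b x <= (\sum_i w i) * 2.
Proof.
by move=> w0; rewrite mulr_suml ler_sum// => i _; rewrite ler_wpM2l ?bracket_le2.
Qed.

Lemma le_mixture w a b w' a' b' x : (forall i, 0 <= w i <= w' i) ->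
  (forall i, [/\ a' i <= a i, a i <= b i & b i <= b' i]) ->
  mixture w a b x <= mixture w' a' b' x.
Proof.
move=> ww ab; apply: ler_sum => i _; have /andP[w0 ww'] := ww i.
by have [? ? ?] := ab i; apply: ler_pM; rewrite ?bracket_ge0 ?le_bracket.
Qed.

Lemma Rintegral_mixture w a b : (forall i, 0 <= w i) ->
  (forall i, [/\ 0 <= a i, a i <= b i & b i <= 1]) ->
  \int[mu]_(x in `[0, 1]) mixture w a b x = \sum_i w i * (1 + b i - a i).
Proof.
move=> w0 ab; rewrite /Rintegral /mixture.
under eq_integral do rewrite -sumEFin.
rewrite ge0_integral_sum//; last 2 first.
- move=> i; apply/measurable_EFinP/measurable_funM => //.
  by apply: measurable_funTS; exact: measurable_bracket.
- by move=> i x _; rewrite lee_fin mulr_ge0 ?bracket_ge0.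
rewrite (eq_bigr (fun i => (w i * (1 + b i - a i))%:E)); first by rewrite sumEFin.
move=> i _; under eq_integral do rewrite EFinM.
rewrite ge0_integralZl//; last 3 first.
- by apply/measurable_EFinP/measurable_funTS; exact: measurable_bracket.
- by move=> x _; rewrite lee_fin bracket_ge0.
- by rewrite lee_fin.
have [a0 abi b1] := ab i; rewrite EFinM -Rintegral_bracket// /Rintegral fineK//.
apply: integrable_fin_num => //.
apply: (@bounded_integrable_itv _ _ _ _ _ _ 2); first exact: measurable_bracket.
by move=> x; rewrite ger0_norm ?bracket_le2 ?bracket_ge0.
Qed.

Lemma polygonal_density (f : R -> R) : polygonal g f ->
  [/\ measurable_fun setT f, forall x, 0 <= f x <= 2,
    forall x, ~~ (0 <= x <= 1) -> f x = 0 &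
    \int[mu]_(x in `[0, 1]) f x = 1].
Proof.
move=> /polygonal_mixture[w [t [w0 w1 t01 ->]]]; split.
- exact: measurable_mixture.
- by move=> x; rewrite mixture_ge0//= (le_trans (mixture_le _ _ _ _))// w1 mul1r.
- move=> x x01; rewrite /mixture big1// => i _.
  by rewrite /bracket (negbTE x01) mulr0.
- rewrite Rintegral_mixture//; last by move=> i; have /andP[] := t01 i.
  by rewrite -[RHS]w1; apply: eq_bigr => i _; rewrite addrK mulr1.
Qed.

(** Each component is coded by the cell of its weight, which is rounded up, and the cell of its
    peak, which is widened to the whole cell. There are [m.+1] cells because the value 1 falls in
    the cell of index [m]; the minimum keeps that last peak interval inside [0, 1]. *)
Definition grid_mixture (m : nat) (k : {ffun 'I_g -> 'I_m.+1 * 'I_m.+1}) : R -> R :=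
  mixture (fun i => (k i).1.+1%:R / m%:R) (fun i => (k i).2%:R / m%:R)
    (fun i => Num.min ((k i).2.+1%:R / m%:R) 1).

(** Choose the cells that contain the weights and peaks of [f]. With [e = 1 / m], each weight grows
    by at most [e] and each envelope has integral at most [1 + e], so the total is at most
    [(1 + g e) (1 + e)], and [e <= 1] bounds this by [1 + (2 g + 1) e]. *)
Lemma grid_mixtureP (m : nat) (f : R -> R) : (0 < m)%N -> polygonal g f ->
  exists k : {ffun 'I_g -> 'I_m.+1 * 'I_m.+1},
    (forall x, f x <= grid_mixture k x) /\
    \int[mu]_(x in `[0, 1]) grid_mixture k x <= 1 + (2 * g + 1)%:R / m%:R.
Proof.
move=> m0 /polygonal_mixture[w [t [w0 w1 t01 ->]]].
have mR0 : 0 < m%:R :> R by rewrite ltr0n.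
have wle1 i : w i <= 1.
  by rewrite -w1 (bigD1 i)//= lerDl sumr_ge0.
have trunc_ltn (y : R) : 0 <= y -> y <= 1 -> (Num.truncn (y * m%:R) < m.+1)%N.
  move=> y0 y1; rewrite ltnS -(ler_nat R).
  have /andP[+ _] := truncn_itv (mulr_ge0 y0 (ltW mR0)); move/le_trans; apply.
  by rewrite ler_piMl// ltW.
pose k := [ffun i => (inord (Num.truncn (w i * m%:R)), inord (Num.truncn (t i * m%:R)))
  : 'I_m.+1 * 'I_m.+1].
have trunc_bounds (y : R) : 0 <= y -> y <= 1 ->
    (@inord m (Num.truncn (y * m%:R)))%:R / m%:R <= y <=
    (@inord m (Num.truncn (y * m%:R))).+1%:R / m%:R.
  move=> y0 y1; rewrite inordK ?trunc_ltn//.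
  have /andP[l u] := truncn_itv (mulr_ge0 y0 (ltW mR0)).
  by rewrite ler_pdivrMr// l ler_pdivlMr// ltW.
have kw i : (k i).1%:R / m%:R <= w i <= (k i).1.+1%:R / m%:R.
  by rewrite ffunE/=; exact: trunc_bounds.
have kt i : (k i).2%:R / m%:R <= t i <= (k i).2.+1%:R / m%:R.
  by rewrite ffunE/=; have /andP[? ?] := t01 i; exact: trunc_bounds.
have k0 i : 0 <= (k i).2%:R / m%:R :> R by rewrite divr_ge0.
exists k; split.
  move=> x; apply: le_mixture => i.
    by have /andP[_ ->] := kw i; rewrite w0.
  have /andP[? ?] := kt i; have /andP[_ ?] := t01 i; split => //.
  by rewrite le_min; apply/andP.
rewrite Rintegral_mixture; last 2 first.
- by move=> i; rewrite divr_ge0.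
- move=> i; have /andP[l u] := kt i; have /andP[_ t1] := t01 i; split => //.
  by rewrite (le_trans l)// le_min u.
pose e : R := m%:R^-1.
have e0 : 0 <= e by rewrite invr_ge0 ltW.
have e1 : e <= 1 by rewrite invf_le1// ler1n.
apply: (@le_trans _ _ (\sum_i (w i + e) * (1 + e))).
  apply: ler_sum => i _; have /andP[lw _] := kw i; apply: ler_pM.
  - by rewrite divr_ge0.
  - have /andP[l u] := kt i; have /andP[_ t1] := t01 i.
    rewrite subr_ge0 (le_trans l)// (le_trans t1)// lerDl le_min ler01 andbT.
    by rewrite divr_ge0.
  - by rewrite -natr1 mulrDl mul1r lerD2r.
  - rewrite -addrA lerD2l lerBlDr ge_min; apply/orP; left.
    by rewrite -natr1 mulrDl mul1r addrC.
rewrite -mulr_suml big_split/= w1 sumr_const card_ord -[e *+ g]mulr_natl.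
rewrite natrD natrM -/e.
have : g%:R * e * e <= g%:R * e by rewrite ler_piMr// mulr_ge0.
lra.
Qed.

End mixture.

(** * Affinity between an upper bracket and the true density *)

Section affinity.
Context {R : realType}.
Local Notation mu := (@lebesgue_measure R).

(** Subadditivity of the root splits [sqrt u] into [sqrt f + sqrt (u - f)]. The first part times
    [sqrt f0] is expressed through the squared difference of roots, the second is bounded by AM-GM
    with parameter [t]. The bound is linear in [f], [f0], [u] and the squared difference, ready for
    termwise integration. *)
Lemma affinity_pointwise (t f f0 u : R) : 0 < t -> 0 <= f <= u -> 0 <= f0 ->
  Num.sqrt (u * f0) <= (2^-1 - t^-1 / 2) * f + (2^-1 + t / 2) * f0
    + (t^-1 / 2) * u + (- 2^-1) * (Num.sqrt f - Num.sqrt f0) ^+ 2.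
Proof.
move=> t0 /andP[f_ge0 fu] f0_ge0; have u0 := le_trans f_ge0 fu.
have uf0 : 0 <= u - f by rewrite subr_ge0.
rewrite sqrtrM//.
have fE := sqr_sqrtr f_ge0; have f0E := sqr_sqrtr f0_ge0.
have uE := sqr_sqrtr u0; have ufE := sqr_sqrtr uf0.
move: (sqrtr_ge0 f) (sqrtr_ge0 f0) (sqrtr_ge0 u) (sqrtr_ge0 (u - f)).
move: (Num.sqrt f) (Num.sqrt f0) (Num.sqrt u) (Num.sqrt (u - f)) fE f0E uE ufE.
move=> a b c s fE f0E uE ufE a0 b0 c0 s0.
have cas : c <= a + s.
  rewrite -(@ler_pXn2r _ 2)// ?nnegrE ?addr_ge0// sqrrD uE fE ufE.
  have : 0 <= a * s by exact: mulr_ge0.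
  by rewrite mulr2n; lra.
have cb : c * b <= a * b + s * b by rewrite -mulrDl ler_wpM2r.
(* AM-GM: 2 s b <= s^2 / t + t b^2 *)
have amgm : 0 <= t^-1 * (s - t * b) ^+ 2 by rewrite mulr_ge0 ?sqr_ge0// invr_ge0 ltW.
have tE : t^-1 * (s - t * b) ^+ 2 = t^-1 * s ^+ 2 - 2 * s * b + t * b ^+ 2.
  by field; rewrite gt_eqF.
rewrite tE ufE f0E in amgm.
have abE : (a - b) ^+ 2 = f - 2 * a * b + f0 by rewrite -fE -f0E; ring.
rewrite abE; lra.
Qed.

(** After integration, the excess [t ^+ 2] of [u], divided by [2 t], costs [t / 2]; the other AM-GM
    term costs [t / 2] as well. The Hellinger term gains at least [2 t], which leaves [1 - t]. *)
Lemma le_affinity (t B : R) (f f0 u : R -> R) : 0 < t ->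
  measurable_fun setT f -> measurable_fun setT f0 -> measurable_fun setT u ->
  (forall x, 0 <= f x <= u x) -> (forall x, u x <= B) ->
  (forall x, 0 <= f0 x <= B) ->
  \int[mu]_(x in `[0, 1]) f x = 1 -> \int[mu]_(x in `[0, 1]) f0 x = 1 ->
  \int[mu]_(x in `[0, 1]) u x <= 1 + t ^+ 2 ->
  4 * t <= hellinger f f0 ^+ 2 ->
  \int[mu]_(x in `[0, 1]) Num.sqrt (u x * f0 x) <= 1 - t.
Proof.
move=> t0 mf mf0 meas_u fu uB f0B f1 f01 u1 hell.
have msqrt : measurable_fun setT (@Num.sqrt R).
  exact: continuous_measurable_fun (@sqrt_continuous R).
have B0 : 0 <= B by have /andP[/le_trans] := f0B 0; apply.
pose q x := (Num.sqrt (f x) - Num.sqrt (f0 x)) ^+ 2.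
have mq : measurable_fun setT q.
  by apply: measurable_funX; apply: measurable_funB; exact: measurableT_comp.
have f_le x : 0 <= f x <= B.
  by have /andP[-> fux] := fu x; rewrite (le_trans fux).
have q_le x : 0 <= q x <= B + B.
  have /andP[f_ge0 fB] := f_le x; have /andP[f0_ge0 f0B'] := f0B x.
  rewrite sqr_ge0/= /q sqrrB !sqr_sqrtr//.
  have : 0 <= Num.sqrt (f x) * Num.sqrt (f0 x) by rewrite mulr_ge0 ?sqrtr_ge0.
  by rewrite mulr2n; lra.
have int (h : R -> R) C : measurable_fun setT h -> (forall x, 0 <= h x <= C) ->
    mu.-integrable `[0, 1] (EFin \o h).
  move=> mh hC; apply: (@bounded_integrable_itv _ _ _ _ _ _ C) => // x.
  by have /andP[h0 ?] := hC x; rewrite ger0_norm.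
have if_ := int _ _ mf f_le.
have if0 := int _ _ mf0 f0B.
have iu : mu.-integrable `[0, 1] (EFin \o u).
  apply: (int _ B) => // x; have /andP[/le_trans fx /fx ->] := fu x.
  exact: uB.
have iq := int _ _ mq q_le.
have intZ (c : R) (h : R -> R) : mu.-integrable `[0, 1] (EFin \o h) ->
    mu.-integrable `[0, 1] (EFin \o (fun x => c * h x)).
  by move=> ih; exact: (integrableZl _ c ih).
have intD (h1 h2 : R -> R) : mu.-integrable `[0, 1] (EFin \o h1) ->
    mu.-integrable `[0, 1] (EFin \o h2) ->
    mu.-integrable `[0, 1] (EFin \o (fun x => h1 x + h2 x)).
  by move=> i1 i2; exact: (integrableD _ i1 i2).
have iuf0 : mu.-integrable `[0, 1] (EFin \o (fun x => Num.sqrt (u x * f0 x))).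
  apply: (int _ B).
    by apply: measurableT_comp => //; exact: measurable_funM.
  move=> x; rewrite sqrtr_ge0/=.
  have /andP[f_ge0 fux] := fu x; have /andP[f0_ge0 f0B'] := f0B x.
  rewrite -[leRHS]ger0_norm// -sqrtr_sqr ler_wsqrtr// expr2.
  by rewrite ler_pM// (le_trans f_ge0).
set c1 := 2^-1 - t^-1 / 2; set c2 := 2^-1 + t / 2; set c3 := t^-1 / 2.
apply: (@le_trans _ _ (\int[mu]_(x in `[0, 1])
    (c1 * f x + c2 * f0 x + c3 * u x + (- 2^-1) * q x))).
  apply: le_Rintegral => //.
    exact: intD _ _ (intD _ _ (intD _ _ (intZ _ _ if_) (intZ _ _ if0)) (intZ _ _ iu)) (intZ _ _ iq).
  move=> x _; apply: affinity_pointwise => //.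
  by have /andP[] := f0B x.
rewrite !RintegralD//; try solve [exact: intZ
  | exact: intD _ _ (intZ _ _ if_) (intZ _ _ if0)
  | exact: intD _ _ (intD _ _ (intZ _ _ if_) (intZ _ _ if0)) (intZ _ _ iu)].
rewrite !RintegralZl// f1 f01 !mulr1.
have hellE : hellinger f f0 ^+ 2 = \int[mu]_(x in `[0, 1]) q x.
  by rewrite /hellinger sqr_sqrtr// Rintegral_ge0// => x _; exact: sqr_ge0.
rewrite hellE in hell.
have c3u : c3 * \int[mu]_(x in `[0, 1]) u x <= c3 * (1 + t ^+ 2).
  by rewrite ler_wpM2l// /c3 divr_ge0// invr_ge0 ltW.
have c3E : c3 * (1 + t ^+ 2) = t^-1 / 2 + t / 2.
  by rewrite /c3; field; rewrite gt_eqF.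
rewrite c3E in c3u; rewrite /c1 /c2; lra.
Qed.

End affinity.

(** * Likelihood of the estimator, and the union bound *)

Lemma mle_prod_le (R : realType) (g n : nat) (x : nat -> R) (f f0 : R -> R) :
  polygonal g f0 -> is_mle g n x f ->
  \prod_(i < n) f0 (x i) <= \prod_(i < n) f (x i).
Proof.
move=> f0P [fP fmax].
(* The extended exponential sends [-oo] to 0, so the identity also covers samples at which [h]
   vanishes. *)
have expE (h : R -> R) : polygonal g h ->
    expeR (log_likelihood n x h) = (\prod_(i < n) h (x i))%:E.
  move=> /polygonal_density[_ h0 _ _].
  rewrite /log_likelihood (big_morph expeR (@expeRD R) (@expeR0 R)) -prodEFin.
  apply: eq_bigr => i _; apply/eqP; rewrite lneK_eq lee_fin.
  by have /andP[] := h0 (x i).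
rewrite -lee_fin -!expE// lee_expeR fmax.
by apply: ereal_sup_ubound; exists f0.
Qed.

Lemma union_bound (d : measure_display) (T : measurableType d) (R : realType)
    (P : probability T R) (I : finType) (E : set T) (G : I -> set T) (c : R) :
  measurable E -> (forall k, measurable (G k)) -> (forall k, (P (G k) <= c%:E)%E) ->
  (forall w, E w -> exists k, G k w) -> (P E <= (#|I|%:R * c)%:E)%E.
Proof.
move=> mE mG Gc EG.
have bound (s : seq I) : measurable (\big[setU/set0]_(k <- s) G k) /\
    (P (\big[setU/set0]_(k <- s) G k) <= ((size s)%:R * c)%:E)%E.
  elim: s => [|k s [ms IH]]; first by rewrite big_nil measure0 mul0r.
  rewrite big_cons; split; first exact: measurableU.
  apply: (le_trans (measureU2 _ _ _)) => //.
  by rewrite /= -natr1 mulrDl mul1r addrC EFinD leeD.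
have [mU PU] := bound (enum I).
rewrite cardE; apply: le_trans PU; apply: le_measure; rewrite ?inE//.
move=> w /EG[k Gk]; rewrite -bigcup_seq; exists k => //=.
by rewrite mem_enum.
Qed.

(** * Numerical consequences of the rate condition *)

Section numeric.
Context {R : realType} (g n : nat) (g_gt0 : (0 < g)%N) (n_gt0 : (0 < n)%N).
Local Notation C := (160 * g%:R : R).


(** The first term of the maximum, divided by [dn] and squared, gives the first bound. The fourth
    power of the second term, divided by [dn ^+ 3], gives [C ^+ 4 <= n ^+ 2 * dn ^+ 5]; its square
    times [n] gives the other. *)
Lemma rate_bounds (dn delta : R) : 0 < dn -> dn <= delta ->
  C * Num.max dn (1 * dn `^ (3 / 4)) <= Num.sqrt n%:R * dn ^+ 2 ->
  C ^+ 2 <= n%:R * delta ^+ 2 /\ n%:R * C ^+ 8 <= (n%:R * delta ^+ 2) ^+ 5.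
Proof.
have g1 : 1 <= g%:R :> R by rewrite ler1n.
have n1 : 1 <= n%:R :> R by rewrite ler1n.
move=> dn0 dnd H; have C0 : 0 < C by lra.
have dd k : dn ^+ k <= delta ^+ k by rewrite lerXn2r ?nnegrE// ?(le_trans (ltW dn0))// ltW.
have sn : Num.sqrt n%:R ^+ 2 = n%:R :> R by rewrite sqr_sqrtr// ler0n.
have s0 : 0 <= Num.sqrt n%:R :> R by exact: sqrtr_ge0.
have H1 : C * dn <= Num.sqrt n%:R * dn ^+ 2.
  by apply: le_trans H; rewrite ler_wpM2l ?(ltW C0)// le_max lexx.
have H2 : C * dn `^ (3 / 4) <= Num.sqrt n%:R * dn ^+ 2.
  by apply: le_trans H; rewrite ler_wpM2l ?(ltW C0)// le_max mul1r lexx orbT.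
split.
  have : C <= Num.sqrt n%:R * dn by rewrite -(ler_pM2r dn0) -[leRHS]mulrA -expr2.
  rewrite -(@ler_pXn2r _ 2)// ?nnegrE ?mulr_ge0 ?(ltW dn0)// => /le_trans; apply.
  by rewrite exprMn sn ler_wpM2l.
have p0 : 0 <= dn `^ (3 / 4) by exact: powR_ge0.
have pE : (dn `^ (3 / 4)) ^+ 4 = dn ^+ 3.
  by rewrite -powR_mulrn// -powRrM divfK// powR_mulrn ?(ltW dn0).
have H4 : C ^+ 4 <= n%:R ^+ 2 * dn ^+ 5.
  rewrite -(@ler_pM2r _ (dn ^+ 3)) ?exprn_gt0// -pE -exprMn.
  have -> : n%:R ^+ 2 * dn ^+ 5 * (dn `^ (3 / 4)) ^+ 4 =
      (Num.sqrt n%:R * dn ^+ 2) ^+ 4 by rewrite pE; move: (Num.sqrt _) sn => s <-; ring.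
  by rewrite lerXn2r ?nnegrE ?mulr_ge0 ?exprn_ge0 ?(ltW dn0).
have H4' : C ^+ 4 <= n%:R ^+ 2 * delta ^+ 5.
  by rewrite (le_trans H4)// ler_wpM2l.
have -> : (n%:R * delta ^+ 2) ^+ 5 = n%:R * (n%:R ^+ 2 * delta ^+ 5) ^+ 2 by ring.
rewrite ler_wpM2l// (_ : C ^+ 8 = (C ^+ 4) ^+ 2); last by ring.
by rewrite lerXn2r ?nnegrE// (le_trans _ H4')// exprn_ge0.
Qed.

(** The hypothesis yields [2 n <= (y / C) ^+ 5], so [(n ^ 2 + 1) ^ 2 <= (2 n) ^ 4] is at most
    [(y / C) ^ 20], hence at most [exp (20 y / C)]. The power [g] makes the exponent [20 g y / C],
    which is [y / 8] precisely because [C = 160 g]. *)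
Lemma grid_card_le (y : R) : 0 <= y -> n%:R * C ^+ 8 <= y ^+ 5 ->
  ((n ^ 2).+1%:R ^+ 2) ^+ g <= expR (y / 8).
Proof.
have g1 : 1 <= g%:R :> R by rewrite ler1n.
have n1 : 1 <= n%:R :> R by rewrite ler1n.
move=> y0 yC; have C0 : 0 < C by lra.
have C1 : 1 <= C by lra.
have n2 : (n ^ 2).+1%:R ^+ 2 <= (2 * n%:R) ^+ 4 :> R.
  rewrite (_ : (2 * n%:R) ^+ 4 = ((2 * n%:R) ^+ 2) ^+ 2 :> R); last by ring.
  rewrite lerXn2r ?nnegrE ?exprn_ge0// ?mulr_ge0// -natr1 natrX.
  have : 1 <= n%:R ^+ 2 :> R by rewrite exprn_ege1.
  by rewrite exprMn; lra.
have n4 : (2 * n%:R) ^+ 4 <= ((y / C) ^+ 5) ^+ 4.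
  rewrite lerXn2r ?nnegrE ?mulr_ge0 ?exprn_ge0 ?divr_ge0//.
  rewrite expr_div_n ler_pdivlMr ?exprn_gt0// (le_trans _ yC)//.
  rewrite (_ : C ^+ 8 = C ^+ 3 * C ^+ 5); last by ring.
  rewrite mulrA ler_wpM2r ?exprn_ge0 ?(ltW C0)// mulrC ler_wpM2l//.
  have : C <= C ^+ 3 by rewrite exprS ler_peMr ?(ltW C0)// exprn_ege1.
  lra.
have yexp : y / C <= expR (y / C).
  by rewrite (le_trans _ (expR_ge1Dx _))// lerDr.
have : ((n ^ 2).+1%:R ^+ 2) ^+ g <= ((expR (y / C) ^+ 5) ^+ 4) ^+ g.
  rewrite lerXn2r ?nnegrE ?exprn_ge0 ?expR_ge0// (le_trans n2)// (le_trans n4)//.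
  by rewrite !lerXn2r ?nnegrE ?exprn_ge0 ?expR_ge0// divr_ge0.
move/le_trans; apply; rewrite -!exprM -expRM_natl ler_expR.
rewrite le_eqVlt; apply/orP; left; apply/eqP.
by rewrite !natrM; field; lra.
Qed.

Lemma union_bound_exp (y : R) : C ^+ 2 <= y -> n%:R * C ^+ 8 <= y ^+ 5 ->
  ((n ^ 2).+1%:R ^+ 2) ^+ g * expR (- (y / 4)) <= C * expR (- (y / C ^+ 2)).
Proof.
have g1 : 1 <= g%:R :> R by rewrite ler1n.
have n1 : 1 <= n%:R :> R by rewrite ler1n.
move=> Cy yC; have C1 : 8 <= C by lra.
have C2 : 8 <= C ^+ 2 by rewrite (le_trans C1)// expr2 ler_peMr; lra.
have y0 : 0 <= y by rewrite (le_trans _ Cy); lra.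
apply: (@le_trans _ _ (expR (y / 8) * expR (- (y / 4)))).
  by rewrite ler_wpM2r ?expR_ge0// grid_card_le.
rewrite -expRD; apply: (@le_trans _ _ (expR (- (y / C ^+ 2)))); last first.
  by rewrite ler_peMl ?expR_ge0//; lra.
rewrite ler_expR.
have : y / C ^+ 2 <= y / 8 by rewrite ler_wpM2l// lef_pV2 ?posrE//; lra.
lra.
Qed.

(** This is the condition on the excess mass in [le_affinity] for [t = delta ^+ 2 / 4]. It amounts
    to [16 (2 g + 1) <= (n delta ^+ 2) ^+ 2], and [n delta ^+ 2] exceeds both 48 and [g]. *)
Lemma grid_fine_enough (delta : R) : C ^+ 2 <= n%:R * delta ^+ 2 ->
  (2 * g + 1)%:R / (n ^ 2)%:R <= (delta ^+ 2 / 4) ^+ 2.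
Proof.
have g1 : 1 <= g%:R :> R by rewrite ler1n.
have n1 : 1 <= n%:R :> R by rewrite ler1n.
move=> H; rewrite ler_pdivrMr ?ltr0n ?expn_gt0 ?n_gt0// natrX.
have -> : (delta ^+ 2 / 4) ^+ 2 * n%:R ^+ 2 = (n%:R * delta ^+ 2) ^+ 2 / 16 by field.
have gg : g%:R <= g%:R ^+ 2 :> R by rewrite expr2 ler_peMr//; lra.
have H' : g%:R <= n%:R * delta ^+ 2.
  by apply: le_trans H; rewrite exprMn; lra.
have H'' : 16 * 3 <= n%:R * delta ^+ 2.
  by apply: le_trans H; rewrite exprMn; lra.
rewrite natrD natrM expr2.
have : 16 * 3 * g%:R <= n%:R * delta ^+ 2 * (n%:R * delta ^+ 2) by rewrite ler_pM//; lra.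
lra.
Qed.

End numeric.

(** * Deviation inequality for the maximum likelihood estimator *)

Theorem proposition3 (R : realType) (g : nat) (g_gt0 : (0 < g)%N)
    (d : measure_display) (Omega : measurableType d) (P : probability Omega R)
    (f0 : R -> R) (f0_polygonal : polygonal g f0)
    (X : nat -> {RV P >-> R}) (X_iid : iid_sample X f0)
    (fhat : nat -> Omega -> R -> R)
    (fhat_mle : forall n, (0 < n)%N -> forall omega,
       is_mle g n (fun j => X j omega) (fhat n omega))
    (fhat_meas : forall n, (0 < n)%N ->
       measurable_fun setT (fun omega => hellinger (fhat n omega) f0)) :
  exists C1 C2' : R, [/\ 0 < C1, 0 < C2' &
    forall delta_ : nat -> R,
      (forall n, (0 < n)%N -> 0 < delta_ n) ->
      (forall n, (0 < n)%N ->
         C1 * Num.max (delta_ n) (C2' * delta_ n `^ (3 / 4)) <=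
         Num.sqrt n%:R * delta_ n ^+ 2) ->
      forall n, (0 < n)%N -> forall delta : R, delta_ n <= delta ->
        (P [set omega | (delta <= hellinger (fhat n omega) f0)%R] <=
         (C1 * expR (- (n%:R * delta ^+ 2 / C1 ^+ 2)))%:E)%E].
Proof.
have [mf0 f0B f0_out f0_int] := polygonal_density f0_polygonal.
have f0_ge0 x : 0 <= f0 x by have /andP[] := f0B x.
exists (160 * g%:R), 1; split; [by rewrite mulr_gt0// ltr0n|by []|].
move=> delta_ delta_gt0 Hdelta n n0 delta dndelta.
have [Cy yC] := rate_bounds g_gt0 n0 (delta_gt0 n n0) dndelta (Hdelta n n0).
have delta0 : 0 < delta := lt_le_trans (delta_gt0 n n0) dndelta.
(* With this [t], [delta <= hellinger f f0] becomes the separation [4 * t <= hellinger f f0 ^+ 2]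
   required by [le_affinity]. *)
pose t := delta ^+ 2 / 4.
have t0 : 0 < t by rewrite divr_gt0// exprn_gt0.
have m0 : (0 < n ^ 2)%N by rewrite expn_gt0 n0.
pose K := {ffun 'I_g -> 'I_(n ^ 2).+1 * 'I_(n ^ 2).+1}.
(* A property of the bracket alone, free of the sample: some density far from [f0] lies below it.
   Such an [f] serves to bound the affinity, so the random estimator drops out; for the other
   brackets the event [G k] is empty. *)
pose good (k : K) := exists f : R -> R, [/\ polygonal g f,
  delta <= hellinger f f0, forall x, f x <= grid_mixture k x &
  \int[@lebesgue_measure R]_(x in `[0, 1]) grid_mixture k x
    <= 1 + (2 * g + 1)%:R / (n ^ 2)%:R :> R].
pose G (k : K) : set Omega := [set w | good k /\
  \prod_(i < n) f0 (X i w) <= \prod_(i < n) grid_mixture k (X i w)].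
have w0 (k : K) i : 0 <= (k i).1.+1%:R / (n ^ 2)%:R :> R by rewrite divr_ge0.
have mG0 k : measurable [set w | \prod_(i < n) f0 (X i w) <=
    \prod_(i < n) (grid_mixture k : R -> R) (X i w)].
  have mprod (v : R -> R) : measurable_fun setT v ->
      measurable_fun setT (fun w => \prod_(i < n) v (X i w)).
    by move=> mv; apply: measurable_prod => i _; exact: measurableT_comp.
  rewrite -[X in measurable X]setTI.
  exact: (measurable_fun_ler (mprod _ mf0) (mprod _ (measurable_mixture _ _ _))
    measurableT (Y := [set true])).
have GE k : good k -> G k = [set w | \prod_(i < n) f0 (X i w) <=
    \prod_(i < n) (grid_mixture k : R -> R) (X i w)].
  by move=> gk; apply/seteqP; split => w /=; [case|].
have GE0 k : ~ good k -> G k = set0.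
  by move=> gk; apply/seteqP; split => w //= [].
have mG k : measurable (G k).
  by have [gk|gk] := pselect (good k); [rewrite GE|rewrite GE0].
have PG k : (P (G k) <= (expR (- (n%:R * delta ^+ 2 / 4)))%:E)%E.
  have [gk|gk] := pselect (good k); last by rewrite GE0// measure0 lee_fin expR_ge0.
  rewrite GE//; have [f [fP fdelta fk ku]] := gk.
  have [mf fB _ f_int] := polygonal_density fP.
  (* A crude common bound for the bracket and [f0], serving integrability; it does not enter the
     final estimate. *)
  pose B := (\sum_i (k i).1.+1%:R / (n ^ 2)%:R) * 2 + 2 : R.
  have B2 : 2 <= B by rewrite lerDr mulr_ge0// sumr_ge0.
  have kB x : grid_mixture k x <= B by rewrite (le_trans (mixture_le _ _ _ _))// lerDl.
  have k0 x : 0 <= (grid_mixture k x : R) by exact: mixture_ge0.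
  have f0B' x : 0 <= f0 x <= B by have /andP[-> /le_trans ->] := f0B x.
  have mk : measurable_fun setT (grid_mixture k : R -> R) by exact: measurable_mixture.
  have sB x : Num.sqrt (grid_mixture k x * f0 x) <= B.
    have B0 : 0 <= B by exact: le_trans B2.
    rewrite -[leRHS]ger0_norm// -sqrtr_sqr ler_wsqrtr// expr2.
    by have /andP[_ ?] := f0B' x; rewrite ler_pM.
  apply: (le_trans (likelihood_ratio X_iid mf0 f0_ge0 n mk k0 sB f0_out)).
  have aff : \int[@lebesgue_measure R]_(x in `[0, 1])
      Num.sqrt (grid_mixture k x * f0 x) <= 1 - t.
    apply: (@le_affinity _ _ B f) => //.
    - by move=> x; have /andP[-> _] := fB x; rewrite fk.
    - by apply: (le_trans ku); rewrite lerD2l grid_fine_enough.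
    - rewrite /t mulrC divfK// lerXn2r ?nnegrE ?(ltW delta0)//.
      exact: sqrtr_ge0.
  have aff0 : 0 <= \int[@lebesgue_measure R]_(x in `[0, 1])
      Num.sqrt (grid_mixture k x * f0 x).
    by apply: Rintegral_ge0 => x _; exact: sqrtr_ge0.
  have -> : - (n%:R * delta ^+ 2 / 4) = n%:R * - t by rewrite /t; ring.
  rewrite lee_fin expRM_natl lerXn2r ?nnegrE ?expR_ge0// (le_trans aff)//.
  exact: expR_ge1Dx.
set E := [set _ | _].
have mE : measurable E.
  rewrite -[E]setTI.
  exact: (measurable_fun_ler (measurable_cst delta) (fhat_meas n n0)
    measurableT (Y := [set true])).
apply: (le_trans (union_bound mE mG PG _)).
  (* The estimator itself witnesses [good] for its own cell, and the likelihood of [f0] is at most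
     that of the estimator, hence at most that of the bracket. *)
  move=> w Ew; have [fP fmax] := fhat_mle n n0 w.
  have [k [fk ku]] := grid_mixtureP m0 fP.
  exists k; split; first by exists (fhat n w).
  apply: (le_trans (mle_prod_le f0_polygonal (fhat_mle n n0 w))).
  have [_ fB _ _] := polygonal_density fP.
  by apply: ler_prod => i _; have /andP[-> _] := fB (X i w); rewrite fk.
rewrite lee_fin card_ffun card_prod !card_ord natrX natrM -expr2.
exact: union_bound_exp.
Qed.
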